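(* Let $R>0$ and $N\ge 1$ an integer. Let $$f_{\mathrm{CI}}(r)=\begin{cases}\frac{4r}{\pi R^2}\cos^{-1}\!\left(\frac{r}{2R}\right)-\frac{2r^2}{\pi R^4}\sqrt{R^2-\tfrac14 r^2}, & 0\le r\le 2R,\\ 0, & r>2R,\end{cases}$$ be the density of the distance between two independent uniformly distributed points in a disk of radius $R$, and let $$\Psi(r)=\frac{1}{\pi}\Big(4\csc^{-1}\!\left(\tfrac{2R}{r}\right)+2\left(\tfrac{r}{R}\right)^2\sec^{-1}\!\left(\tfrac{2R}{r}\right)-2\tan^{-1}\!\left(\tfrac{r}{\sqrt{4R^2-r^2}}\right)-\tfrac{r(r^2+2R^2)\sqrt{4R^2-r^2}}{4R^4}\Big),\quad 0<r<2R.$$ Suppose a device has $N$ aggregators whose distances $R_1,\dots,R_N$ to the device are i.i.d. with density $f_{\mathrm{CI}}$, and the device connects to the nearest one, at distance $r=\min_i R_i$. Let $\hat P_o>0$, $P_{\max}>0$, $P_{\mathrm{CP}}\ge0$, $\eta>0$, $\epsilon\in(0,1]$, $\alpha_{\mathrm g}>0$; the transmit power is $P_T=\min\{\hat P_o r^{\epsilon\alpha_{\mathrm g}},P_{\max}\}$ and $P_{\mathrm{TX}}=P_{\mathrm{CP}}+\eta^{-1}P_T$. Then $$\mathbb{E}[P_{\mathrm{TX}}]=P_{\mathrm{CP}}+\eta^{-1}N\Big(P_{\max}\int_{\zeta_{\mathrm{CI}}}^{2R}f_{\mathrm{CI}}(r)(1-\Psi(r))^{N-1}dr+\hat P_o\int_0^{\zeta_{\mathrm{CI}}}r^{\epsilon\alpha_{\mathrm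 g}}f_{\mathrm{CI}}(r)(1-\Psi(r))^{N-1}dr\Big),$$ where $\zeta_{\mathrm{CI}}=\min\{2R,(P_{\max}/\hat P_o)^{1/(\epsilon\alpha_{\mathrm g})}\}$. Moreover, for $L_o>0$, $\mu>0$, path loss $l(r)=L_o r^{\alpha_{\mathrm g}}$ and $\hat\mu=\mu/L_o$, $$\mathbb{P}(l(r)\le\mu)=N\int_0^{\min\{\hat\mu^{1/\alpha_{\mathrm g}},2R\}}f_{\mathrm{CI}}(r)(1-\Psi(r))^{N-1}dr,$$ which for $N=1$ equals $\min\{\Psi(\min\{\hat\mu^{1/\alpha_{\mathrm g}},2R\}),1\}$.
   Context: ''Cluster-interior deployment'': devices are uniformly distributed in a disk of radius $R$ and $N$ terrestrial aggregators are placed uniformly at random in the same disk; each device connects to its nearest aggregator. The path loss at distance $r$ is $L_o r^{\alpha_{\mathrm g}}$. Devices use fractional power control with factor $\epsilon$, open-loop constant $\hat P_o$ and maximum transmit power $P_{\max}$; $P_{\mathrm{CP}}$ is the circuit power and $\eta$ the power amplifier efficiency. The IoT coverage at maximum coupling loss $\mu$ (linear) is the probability that the path loss is at most $\mu$. *)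

(* Defs.v *)
From HB Require Import structures.
From mathcomp Require Import all_boot all_order all_algebra.
From mathcomp Require Import all_classical all_reals all_analysis.
Set Implicit Arguments. Unset Strict Implicit. Unset Printing Implicit Defensive.
Import Order.TTheory GRing.Theory Num.Theory.
Import numFieldNormedType.Exports.
Local Open Scope classical_set_scope.
Local Open Scope ring_scope.

(* density of the distance between two independent uniform points in a disk
   of radius Rd; zero outside [0, 2 Rd] *)
Definition fCI {R : realType} (Rd r : R) : R :=
  if (0 <= r) && (r <= 2 * Rd) then
    4 * r / (pi * Rd ^+ 2) * acos (r / (2 * Rd))
    - 2 * r ^+ 2 / (pi * Rd ^+ 4) * Num.sqrt (Rd ^+ 2 - r ^+ 2 / 4)
  else 0.

(* Psi, literally as in the paper (intended for 0 < r < 2 Rd);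
   csc^{-1}(x) = asin (1/x), sec^{-1}(x) = acos (1/x). *)
Definition PsiCI {R : realType} (Rd r : R) : R :=
  pi^-1 * (4 * asin (r / (2 * Rd))
           + 2 * (r / Rd) ^+ 2 * acos (r / (2 * Rd))
           - 2 * atan (r / Num.sqrt (4 * Rd ^+ 2 - r ^+ 2))
           - r * (r ^+ 2 + 2 * Rd ^+ 2) * Num.sqrt (4 * Rd ^+ 2 - r ^+ 2)
             / (4 * Rd ^+ 4)).

(* pointwise minimum of a finite nonempty family of real functions
   (value 0 for the empty family, never used since N >= 1) *)
Definition minfam {T : Type} {R : realType} (N : nat) (X : 'I_N -> T -> R)
  (t : T) : R :=
  match [seq X i t | i <- enum 'I_N] with
  | x :: s => foldr Num.min x s
  | [::] => 0
  end.

Definition mutually_independent {d : measure_display} {T : measurableType d}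
  {R : realType} (P : probability T R) (N : nat) (X : 'I_N -> T -> R) : Prop :=
  forall B : 'I_N -> set R, (forall i, measurable (B i)) ->
    P (\big[setI/setT]_(i < N) (X i @^-1` B i)) =
    (\prod_(i < N) P (X i @^-1` B i))%E.

Definition has_density {d : measure_display} {T : measurableType d}
  {R : realType} (P : probability T R) (Y : T -> R) (f : R -> R) : Prop :=
  forall A : set R, measurable A ->
    P (Y @^-1` A) = (\int[@lebesgue_measure R]_(x in A) (f x)%:E)%E.

Definition PT {R : realType} (Po Pmax eps ag r : R) : R :=
  Num.min (Po * r `^ (eps * ag)) Pmax.
Definition PTX {R : realType} (Pcp eta Po Pmax eps ag r : R) : R :=
  Pcp + eta^-1 * PT Po Pmax eps ag r.

(* Main.v *)
Require Import Defs.
From HB Require Import structures.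
From mathcomp Require Import all_boot all_order all_algebra.
From mathcomp Require Import all_classical all_reals all_analysis.
From mathcomp Require Import measurable_realfun.
From mathcomp Require Import ring lra.
Set Implicit Arguments. Unset Strict Implicit. Unset Printing Implicit Defensive.
Import Order.TTheory GRing.Theory Num.Theory.
Import numFieldNormedType.Exports.
Local Open Scope classical_set_scope.
Local Open Scope ring_scope.

(** With [x = r / (2 * Rd)], the distance to one aggregator has density
[disk_pdf x / (2 * Rd)], and [PsiCI Rd r = disk_cdf x] is its primitive. By
independence the nearest of [n + 1] aggregators lies beyond [t] with probability
[(1 - Psi t) ^ (n + 1)], which by the fundamental theorem of calculus is the
integral of [(n + 1) f (1 - Psi) ^ n] over the ray beyond [t]. Rays generate the
Borel sets and are closed under intersection, so this function is the density of
the nearest distance; both formulas integrate against it, the power splitting at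
the distance where the transmit power saturates. *)


(** * Inverse trigonometric identities *)

Lemma asin_ge0 (R : realType) (x : R) : 0 <= x <= 1 -> 0 <= asin x.
Proof.
move=> /andP[x0 x1]; have x01 : -1 <= x <= 1 by lra.
have pi0 := pi_gt0 R.
have /andP[aN aP] : - (pi / 2) <= asin x <= pi / 2.
  by rewrite asin_geNpi2// asin_lepi2.
rewrite leNgt; apply/negP => as0.
have : sin (asin x) < sin 0.
  by rewrite ltr_sin// in_itv/=; apply/andP; split; lra.
by rewrite asinK// sin0 ltNge x0.
Qed.

Lemma acosE_asin (R : realType) (x : R) : -1 <= x <= 1 ->
  acos x = pi / 2 - asin x.
Proof.
move=> x1; have aN := @asin_geNpi2 R _ x1; have aP := @asin_lepi2 R x x1.
rewrite -[RHS]cosK; last by rewrite in_itv/=; apply/andP; split; lra.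
by rewrite cosB cos_pihalf sin_pihalf mul0r mul1r add0r asinK.
Qed.

(** Half-angle formula: [cos (2 * a) = 1 - 2 * sin a ^+ 2], and doubling an arcsine of a nonnegative
    number lands in [[0, pi]], where [acos] inverts [cos]. *)
Lemma acosE_half (R : realType) (x : R) : -1 <= x <= 1 ->
  acos x = 2 * asin (Num.sqrt ((1 - x) / 2)).
Proof.
move=> /andP[x1 x2]; set s := Num.sqrt _.
have s2 : s ^+ 2 = (1 - x) / 2 by rewrite sqr_sqrtr//; lra.
have s0 : 0 <= s by exact: sqrtr_ge0.
have s1 : s <= 1 by nra.
have sb : -1 <= s <= 1 by lra.
have aP := @asin_lepi2 R _ sb.
have aN : 0 <= asin s by apply: asin_ge0; rewrite s0.
rewrite -[RHS]cosK; last by rewrite in_itv/=; apply/andP; split; lra.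
rewrite mulr_natl cos_mulr2n cos2sin2 asinK// s2.
by congr acos; rewrite mulr2n; lra.
Qed.

(** The quotient is the tangent of [asin x]; the strict bounds keep that angle inside the open
    interval where [atan] inverts [tan]. *)
Lemma atan_asin (R : realType) (x : R) : -1 < x < 1 ->
  atan (x / Num.sqrt (1 - x ^+ 2)) = asin x.
Proof.
move=> /andP[x1 x2]; have xb : -1 <= x <= 1 by lra.
have aN : - (pi / 2) < asin x by apply: asin_gtNpi2; lra.
have aP : asin x < pi / 2 by apply: asin_ltpi2; lra.
rewrite -[RHS]tanK; last by rewrite in_itv/= aN.
by rewrite /tan asinK// cos_asin.
Qed.

Lemma sin_le_id (R : realType) (x : R) : 0 <= x -> sin x <= x.
Proof.
move=> x0.
have D (y : R) : is_derive y 1 (fun z => z - sin z) (1 - cos y).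
  exact: is_deriveB.
have := @ger0_derive1_le_cc R (fun z => z - sin z) 0 x.
move=> /(_ _ _ _ 0 x); rewrite sin0 subr0 subr_ge0; apply=> //.
- by move=> y _; rewrite derive1E derive_val subr_ge0 cos_le1.
- by apply: derivable_within_continuous => y _; exact: ex_derive.
- by rewrite in_itv/= lexx x0.
- by rewrite in_itv/= lexx x0.
Qed.

(** With [x = cos a] this reads [cos a * sin a <= sin a <= a]. It will give the sign of
    [disk_pdf]. *)
Lemma sqrt1B_mul_le_acos (R : realType) (x : R) : 0 <= x <= 1 ->
  x * Num.sqrt (1 - x ^+ 2) <= acos x.
Proof.
move=> /andP[x0 x1]; have xb : -1 <= x <= 1 by lra.
rewrite -sin_acos//; have a0 := @acos_ge0 R _ xb.
have s0 : 0 <= sin (acos x) by apply: sin_ge0_pi; rewrite a0 acos_lepi.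
apply: le_trans (sin_le_id a0).
by rewrite ler_piMl.
Qed.
(* Equal to [acos] on [-1, 1] but continuous beyond 1, so that the right end of
   the support needs no one-sided limits. *)
Definition acosx {R : realType} (x : R) : R := 2 * asin (Num.sqrt ((1 - x) / 2)).

Lemma continuous_acosx (R : realType) (x : R) : -1 < x ->
  {for x, continuous (@acosx R)}.
Proof.
move=> x1; apply: continuousM; first exact: cvg_cst.
have cs : {for x, continuous (fun y : R => Num.sqrt ((1 - y) / 2))}.
  apply: (@continuous_comp _ _ _ (fun y : R => (1 - y) / 2) Num.sqrt).
    apply: continuousM; last exact: cvg_cst.
    by apply: continuousB; [exact: cvg_cst|exact: cvg_id].
  exact: sqrt_continuous.
apply: (continuous_comp cs); apply: continuous_asin.
(* The hypothesis [-1 < x] keeps the root strictly below 1, away from the endpoint of the domain of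
   [asin]. *)
have s0 := sqrtr_ge0 ((1 - x) / 2); apply/andP; split; first lra.
by rewrite -[ltRHS]sqrtr1 ltr_sqrt//; lra.
Qed.

Lemma is_derive_acosx (R : realType) (x : R) : -1 < x < 1 ->
  is_derive x 1 (@acosx R) (- (Num.sqrt (1 - x ^+ 2))^-1).
Proof.
move=> x1; apply: (@near_eq_is_derive _ _ _ acos).
have : x \in `](-1), 1[ by rewrite in_itv.
move=> /near_in_itvoo; apply: filterS => y; rewrite in_itv/= => /andP[y0 y1].
by rewrite acosE_half//; lra.
Qed.

(** * Density and distribution function of the distance divided by the diameter *)

Definition disk_pdf {R : realType} (x : R) : R :=
  16 / pi * (x * acosx x - x ^+ 2 * Num.sqrt (1 - x ^+ 2)).

(** The function [Psi] with all its inverse functions reduced to one arccosine. The leading 1 comes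
    from [2 * asin x = pi - 2 * acos x]. *)
Definition disk_cdf {R : realType} (x : R) : R :=
  1 - pi^-1 * ((2 - 8 * x ^+ 2) * acosx x
               + 2 * (2 * x ^+ 3 + x) * Num.sqrt (1 - x ^+ 2)).

(** Continuity holds on the whole line because [Num.sqrt] is 0 on negative numbers. *)
Lemma continuous_sqrt1B (R : realType) :
  continuous (fun x : R => Num.sqrt (1 - x ^+ 2)).
Proof.
move=> x; apply: (@continuous_comp _ _ _ (fun y : R => 1 - y ^+ 2) Num.sqrt).
  by apply: continuousB; [exact: cvg_cst|exact: exprn_continuous].
exact: sqrt_continuous.
Qed.

Lemma continuous_disk_pdf (R : realType) (x : R) : -1 < x ->
  {for x, continuous (@disk_pdf R)}.
Proof.
move=> x1; apply: continuousM; first exact: cvg_cst.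
apply: continuousB; apply: continuousM.
- exact: cvg_id.
- exact: continuous_acosx.
- exact: exprn_continuous.
- exact: continuous_sqrt1B.
Qed.

Lemma continuous_disk_cdf (R : realType) (x : R) : -1 < x ->
  {for x, continuous (@disk_cdf R)}.
Proof.
move=> x1; apply: continuousB; first exact: cvg_cst.
apply: continuousM; first exact: cvg_cst.
apply: continuousD; apply: continuousM.
- apply: continuousB; first exact: cvg_cst.
  by apply: continuousM; [exact: cvg_cst|exact: exprn_continuous].
- exact: continuous_acosx.
- apply: continuousM; first exact: cvg_cst.
  apply: continuousD; last exact: cvg_id.
  by apply: continuousM; [exact: cvg_cst|exact: exprn_continuous].
- exact: continuous_sqrt1B.
Qed.

Lemma is_derive_disk_cdf (R : realType) (x : R) : -1 < x < 1 ->
  is_derive x 1 (@disk_cdf R) (disk_pdf x).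
Proof.
move=> x1; have /andP[x1l x1r] := x1.
have s_gt0 : 0 < 1 - x ^+ 2 by nra.
have Da := is_derive_acosx x1.
have Ds : is_derive x 1 (fun y : R => Num.sqrt (1 - y ^+ 2))
    ((2 * Num.sqrt (1 - x ^+ 2))^-1 * - (2 * x)).
  apply: (@is_derive1_comp _ Num.sqrt (fun y : R => 1 - y ^+ 2)).
    exact: is_derive1_sqrt.
  by apply: is_derive_eq; rewrite /GRing.scale/=; ring.
rewrite /disk_cdf; apply: is_derive_eq; rewrite /disk_pdf /GRing.scale/=.
have pi0 : (pi : R) != 0 by rewrite gt_eqF ?pi_gt0.
have : Num.sqrt (1 - x ^+ 2) ^+ 2 = 1 - x ^+ 2 by rewrite sqr_sqrtr// ltW.
have : Num.sqrt (1 - x ^+ 2) != 0 by rewrite gt_eqF// sqrtr_gt0.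
move: (Num.sqrt _) (acosx x) => s a s0 s2; apply/eqP; rewrite -subr_eq0.
(* The arccosine terms cancel, and what is left of the difference of the two sides is a multiple of
   the relation [s ^+ 2 = 1 - x ^+ 2]. *)
rewrite [X in X == _](_ : _ =
  (4 * x ^+ 2 - 2) / (pi * s) * (s ^+ 2 - (1 - x ^+ 2))); last first.
  by move: (pi : R) pi0 => p p0; field; rewrite p0 s0.
by rewrite s2 subrr mulr0.
Qed.

Lemma disk_pdf_ge0 (R : realType) (x : R) : 0 <= x <= 1 -> 0 <= disk_pdf x.
Proof.
move=> x01; have /andP[x0 x1] := x01.
rewrite /disk_pdf mulr_ge0 ?divr_ge0 ?pi_ge0//.
rewrite expr2 -mulrA -mulrBr mulr_ge0// subr_ge0 /acosx -acosE_half; last lra.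
exact: sqrt1B_mul_le_acos.
Qed.

Lemma disk_pdf1 (R : realType) : disk_pdf 1 = 0 :> R.
Proof.
by rewrite /disk_pdf /acosx -acosE_half ?acos1 ?expr1n ?subrr ?sqrtr0; [ring|lra].
Qed.

Lemma disk_cdf0 (R : realType) : disk_cdf 0 = 0 :> R.
Proof.
rewrite /disk_cdf /acosx -acosE_half; last lra.
have pi0 : (pi : R) != 0 by rewrite gt_eqF ?pi_gt0.
by rewrite acos0; move: (pi : R) pi0 => p p0; field.
Qed.

Lemma disk_cdf1 (R : realType) : disk_cdf 1 = 1 :> R.
Proof.
by rewrite /disk_cdf /acosx -acosE_half ?acos1 ?expr1n ?subrr ?sqrtr0; [ring|lra].
Qed.

(** Its derivative [disk_pdf] is nonnegative, so [disk_cdf] increases from 0 at 0 to 1 at 1. *)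
Lemma disk_cdf_itv (R : realType) (x : R) : 0 <= x <= 1 -> 0 <= disk_cdf x <= 1.
Proof.
move=> /andP[x0 x1].
have nd : {in `[0, 1] &, {homo @disk_cdf R : y z / y <= z}}.
  apply: ger0_derive1_le_cc => [y|y|].
  - rewrite in_itv/= => y01; have y1 : -1 < y < 1 by lra.
    have D := is_derive_disk_cdf y1; exact: ex_derive.
  - rewrite in_itv/= => y01; have y1 : -1 < y < 1 by lra.
    have D := is_derive_disk_cdf y1.
    by rewrite derive1E derive_val disk_pdf_ge0//; lra.
  - apply: continuous_in_subspaceT => y; rewrite inE/= in_itv/= => y01.
    by apply: continuous_disk_cdf; lra.
by rewrite -{1}(disk_cdf0 R) -(disk_cdf1 R) !nd// ?in_itv/=; lra.
Qed.

(** * Rescaling [fCI] and [PsiCI] by the diameter *)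

Section cluster_interior.
Context {R : realType} (Rd : R).
Hypothesis Rd_gt0 : 0 < Rd.

Lemma fCI_out (r : R) : r \notin `[0, 2 * Rd] -> fCI Rd r = 0.
Proof. by rewrite in_itv/= /fCI => /negbTE ->. Qed.

Lemma sqrt_fCI (r : R) : 0 <= r ->
  Num.sqrt (4 * Rd ^+ 2 - r ^+ 2) = 2 * Rd * Num.sqrt (1 - (r / (2 * Rd)) ^+ 2).
Proof.
move=> r0; have R0 : Rd != 0 by rewrite gt_eqF.
rewrite -{1}[2 * Rd]gtr0_norm ?mulr_gt0// -sqrtr_sqr -sqrtrM ?sqr_ge0//.
by congr Num.sqrt; field.
Qed.

Lemma scaled_itv (r : R) : 0 <= r <= 2 * Rd -> 0 <= r / (2 * Rd) <= 1.
Proof.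
move=> /andP[r0 r1].
by rewrite divr_ge0 ?ler_pdivrMr ?mul1r ?mulr_ge0// ?mulr_gt0// ltW.
Qed.

Lemma fCIE (r : R) : 0 <= r <= 2 * Rd ->
  fCI Rd r = disk_pdf (r / (2 * Rd)) / (2 * Rd).
Proof.
move=> r02; have R0 : Rd != 0 by rewrite gt_eqF.
have pi0 : (pi : R) != 0 by rewrite gt_eqF ?pi_gt0.
have x01 := scaled_itv r02; have /andP[r0 r2] := r02.
rewrite /fCI r02 /disk_pdf /acosx -acosE_half; last lra.
rewrite (_ : Rd ^+ 2 - r ^+ 2 / 4 = 2^-1 ^+ 2 * (4 * Rd ^+ 2 - r ^+ 2));
  last by field.
rewrite sqrtrM ?sqr_ge0// sqrtr_sqr ger0_norm// sqrt_fCI//.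
move: (acos _) (Num.sqrt _) => a s.
by move: (pi : R) pi0 => p p0; field; rewrite p0 R0.
Qed.

(** The arctangent equals the arcsine and cancels half of the arcsine term; the rest is rewritten
    with the arccosine. The strict upper bound is what [atan_asin] asks for. *)
Lemma PsiCIE (r : R) : 0 <= r < 2 * Rd -> PsiCI Rd r = disk_cdf (r / (2 * Rd)).
Proof.
move=> /andP[r0 r2]; have R0 : Rd != 0 by rewrite gt_eqF.
have pi0 : (pi : R) != 0 by rewrite gt_eqF ?pi_gt0.
have /andP[x0 x1] : 0 <= r / (2 * Rd) <= 1 by rewrite scaled_itv// r0 ltW.
have x1' : r / (2 * Rd) < 1 by rewrite ltr_pdivrMr ?mul1r// mulr_gt0.
rewrite /PsiCI /disk_cdf /acosx -acosE_half; last lra.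
rewrite sqrt_fCI//.
rewrite (_ : r / (2 * Rd * _) =
  r / (2 * Rd) / Num.sqrt (1 - (r / (2 * Rd)) ^+ 2)); last first.
  by rewrite invfM mulrA.
rewrite atan_asin; last lra.
have -> : asin (r / (2 * Rd)) = pi / 2 - acos (r / (2 * Rd)).
  by rewrite acosE_asin; lra.
move: (acos _) (Num.sqrt _) => a s.
by move: (pi : R) pi0 => p p0; field; rewrite p0 R0.
Qed.

End cluster_interior.

(** * Integrals of the density of the nearest distance *)

Section nearest_density.
Context {R : realType} (Rd : R).
Hypothesis Rd_gt0 : 0 < Rd.
Local Notation mu := (@lebesgue_measure R).
Local Notation g n := (fun r => fCI Rd r * (1 - PsiCI Rd r) ^+ n).
(** A continuous stand-in for [g n] on the support: [PsiCI] jumps at [2 * Rd], while [disk_cdf] is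
    continuous there. *)
Local Notation gx n := (fun r : R =>
  disk_pdf (r / (2 * Rd)) / (2 * Rd) * (1 - disk_cdf (r / (2 * Rd))) ^+ n).

(* At [r = 2 * Rd] the literal [PsiCI] takes the junk value 2 (its [atan] term is
   [atan (r / 0) = 0]), but [fCI] vanishes there. *)
Lemma fCI_PsiCIE n (r : R) : 0 <= r <= 2 * Rd -> g n r = gx n r.
Proof.
move=> r02; rewrite /= fCIE//; have /andP[r0] := r02.
rewrite le_eqVlt => /predU1P[->|r2].
  by rewrite divff ?gt_eqF ?mulr_gt0// disk_pdf1 !mul0r.
by rewrite PsiCIE// r0.
Qed.

Let continuous_scale : continuous (fun r : R => r / (2 * Rd)).
Proof. by move=> r; apply: cvgM; [exact: cvg_id|exact: cvg_cst]. Qed.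

Let scale_gtN1 (r : R) : 0 <= r -> -1 < r / (2 * Rd).
Proof.
move=> r0; apply: (@lt_le_trans _ _ 0) => //.
by rewrite divr_ge0// mulr_ge0// ltW.
Qed.

Lemma continuous_fCI_PsiCI n (r : R) : 0 <= r -> {for r, continuous (gx n)}.
Proof.
move=> r0; have x1 := scale_gtN1 r0.
apply: continuousM.
  apply: continuousM; last exact: cvg_cst.
  apply: (@continuous_comp _ _ _ (fun r : R => r / (2 * Rd)) disk_pdf);
    [exact: continuous_scale|exact: continuous_disk_pdf].
apply: (@continuous_comp _ _ _ (fun r : R => 1 - disk_cdf (r / (2 * Rd)))
  (fun y => y ^+ n)); last exact: exprn_continuous.
apply: continuousB; first exact: cvg_cst.
apply: (@continuous_comp _ _ _ (fun r : R => r / (2 * Rd)) disk_cdf);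
    [exact: continuous_scale|exact: continuous_disk_cdf].
Qed.

Lemma within_continuous_fCI_PsiCI n (a b : R) : 0 <= a ->
  {within `[a, b], continuous (gx n)}.
Proof.
move=> a0; apply: continuous_in_subspaceT => r.
rewrite inE/= in_itv/= => /andP[ar _].
by apply: continuous_fCI_PsiCI; exact: le_trans ar.
Qed.

(** [g n] is the extension by zero of a function continuous on the support. *)
Lemma measurable_fCI_PsiCI n : measurable_fun setT (g n).
Proof.
rewrite [X in measurable_fun _ X](_ : _ = (gx n) \_ `[0, 2 * Rd]).
  apply/measurable_restrict => //; rewrite setTI.
  apply: subspace_continuous_measurable_fun => //.
  exact: within_continuous_fCI_PsiCI.
apply/funext => r; rewrite patchE; case: ifPn => [|].
  by rewrite inE/= in_itv/= => /fCI_PsiCIE.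
by rewrite notin_setE/= => /negP /fCI_out ->; rewrite mul0r.
Qed.

Lemma fCI_PsiCI_ge0 n (r : R) : 0 <= g n r.
Proof.
have [r02|/fCI_out ->] := boolP (r \in `[0, 2 * Rd]); last by rewrite mul0r.
rewrite in_itv/= in r02; rewrite fCI_PsiCIE//.
have x01 := scaled_itv Rd_gt0 r02.
have := disk_cdf_itv x01 => /andP[_ Q1].
rewrite mulr_ge0 ?exprn_ge0 ?subr_ge0//.
by rewrite divr_ge0 ?disk_pdf_ge0// ltW// mulr_gt0.
Qed.

Lemma integral_fCI_PsiCI n (a b : R) : 0 <= a -> a <= b -> b <= 2 * Rd ->
  (\int[mu]_(r in `[a, b]) (n.+1%:R * g n r)%:E =
   ((1 - disk_cdf (a / (2 * Rd))) ^+ n.+1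
    - (1 - disk_cdf (b / (2 * Rd))) ^+ n.+1)%:E)%E.
Proof.
move=> a0; rewrite le_eqVlt => /predU1P[<- _|ab b2].
  by rewrite set_itv1 integral_set1 subrr.
have b0 := le_lt_trans a0 ab.
(* This is the antiderivative: the chain rule brings out the factor [n.+1] and the density of a
   single distance. *)
pose F r := - (1 - disk_cdf (r / (2 * Rd))) ^+ n.+1.
have cF r : 0 <= r -> {for r, continuous F}.
  move=> r0; have x1 := scale_gtN1 r0.
  apply: continuousN.
  apply: (@continuous_comp _ _ _ (fun r : R => 1 - disk_cdf (r / (2 * Rd)))
    (fun y => y ^+ n.+1)); last exact: exprn_continuous.
  apply: continuousB; first exact: cvg_cst.
  apply: (@continuous_comp _ _ _ (fun r : R => r / (2 * Rd)) disk_cdf);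
    [exact: continuous_scale|exact: continuous_disk_cdf].
have dF r : r \in `]a, b[ -> is_derive r 1 F (n.+1%:R * gx n r).
  rewrite in_itv/= => /andP[ar rb].
  have x1 : -1 < r / (2 * Rd) < 1.
    rewrite ltr_pdivrMr ?mul1r ?mulr_gt0// (lt_le_trans rb b2) andbT.
    by rewrite scale_gtN1// ltW// (le_lt_trans a0).
  have Dx : is_derive r 1 (fun r : R => r / (2 * Rd)) (2 * Rd)^-1.
    by apply: is_derive_eq; rewrite /GRing.scale/=; ring.
  have DQ : is_derive r 1 (fun r : R => disk_cdf (r / (2 * Rd)))
      (disk_pdf (r / (2 * Rd)) * (2 * Rd)^-1).
    exact: (@is_derive1_comp _ disk_cdf (fun r : R => r / (2 * Rd)) _ _ _
      (is_derive_disk_cdf x1) Dx).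
  pose Fx (y : R) := - (1 - y) ^+ n.+1.
  have DFx (y : R) : is_derive y 1 Fx (n.+1%:R * (1 - y) ^+ n).
    have D1 : is_derive y 1 (fun z : R => 1 - z) (- 1).
      by apply: is_derive_eq; ring.
    rewrite (_ : Fx = - ((fun z : R => 1 - z) ^+ n.+1)); last first.
      by apply/funext => z; rewrite opprfctE exprfctE.
    have DX := @is_deriveX _ _ _ n.+1 y 1 _ D1.
    apply: (is_derive_eq (is_deriveN DX)).
    by rewrite /GRing.scale/= mulrN1 opprK mulr_natl.
  have DF := @is_derive1_comp _ Fx (fun r : R => disk_cdf (r / (2 * Rd)))
    _ _ _ (DFx _) DQ.
  by apply: (is_derive_eq DF); rewrite [RHS]mulrA [RHS]mulrAC.
transitivity (\int[mu]_(r in `[a, b]) (n.+1%:R * gx n r)%:E)%E.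
  apply: eq_integral.
  move=> r; rewrite inE/= in_itv/= => /andP[ar rb].
  by rewrite fCI_PsiCIE// (le_trans a0 ar) (le_trans rb).
rewrite (@continuous_FTC2 _ _ F)//.
- by rewrite /F -EFinB opprK addrC.
- apply: continuous_in_subspaceT => r; rewrite inE/= in_itv/= => /andP[ar _].
  apply: cvgM; first exact: cvg_cst.
  by apply: continuous_fCI_PsiCI; exact: le_trans ar.
- split.
  + by move=> r /dF D; exact: ex_derive.
  (* The one-sided limits at both ends follow from two-sided continuity of [F], which holds even at
     [2 * Rd] because [acosx] continues past 1. *)
  + by apply/cvg_at_right_filter/cF.
  + by apply/cvg_at_left_filter/cF; exact: ltW.
- by move=> r /dF D; rewrite derive1E derive_val.
Qed.

(** The probability that one aggregator lies farther than [r], as the ray integral below shows for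
    [n = 0]. *)
Definition disk_survival (r : R) : R :=
  if r < 0 then 1 else if r < 2 * Rd then 1 - disk_cdf (r / (2 * Rd)) else 0.

(** The weight [h] will be the constant [n.+1] for tails and coverage, and the transmit power for
    the mean. *)
Lemma integral_fCI_PsiCI_support n (h : R -> R) (A : set R) : measurable A ->
  (\int[mu]_(r in A) (h r * g n r)%:E =
   \int[mu]_(r in A `&` `[0%R, (2 * Rd)%R]) (h r * g n r)%:E)%E.
Proof.
move=> mA; rewrite [RHS]integral_mkcondr; apply: eq_integral => r rA.
rewrite patchE; case: ifPn => //; rewrite notin_setE/= => /negP /fCI_out ->.
by rewrite mul0r mulr0.
Qed.

Lemma integral_fCI_PsiCI_ray n (t : R) :
  (\int[mu]_(r in `]t, +oo[) (n.+1%:R * g n r)%:E =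
   (disk_survival t ^+ n.+1)%:E)%E.
Proof.
have R2 : 0 < 2 * Rd by rewrite mulr_gt0.
have mg (A : set R) : measurable_fun A (fun r => (n.+1%:R * g n r)%:E).
  apply/measurable_EFinP/measurable_funTS/measurable_funM => //.
  exact: measurable_fCI_PsiCI.
rewrite integral_fCI_PsiCI_support//.
rewrite /disk_survival; have [t0|t0] := ltP t 0.
- rewrite [X in integral _ X](_ : _ = `[0, 2 * Rd]%classic).
    rewrite integral_fCI_PsiCI// ?ltW// mul0r disk_cdf0.
    rewrite divff ?gt_eqF// disk_cdf1.
    by rewrite subr0 subrr expr0n/= subr0.
  apply/seteqP; split=> r /=; rewrite !in_itv/= andbT; first by case.
  by move=> /andP[r0 r2]; rewrite (lt_le_trans t0) r0.
- have [t2|t2] := ltP t (2 * Rd).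
  + rewrite [X in integral _ X](_ : _ = `]t, 2 * Rd]%classic).
      (* Adding the endpoint [t], a null set, gives the closed interval treated above. *)
      rewrite integral_itv_obnd_cbnd// integral_fCI_PsiCI// ?ltW//.
      by rewrite divff ?gt_eqF// disk_cdf1 subrr expr0n/= subr0.
    apply/seteqP; split=> r /=; rewrite !in_itv/= andbT.
      by move=> [-> /andP[_ ->]].
    by move=> /andP[tr ->]; rewrite tr (ltW (le_lt_trans t0 tr)).
  + rewrite [X in integral _ X](_ : _ = set0) ?integral_set0 ?expr0n//.
    rewrite -subset0 => r /=; rewrite !in_itv/= andbT => -[tr /andP[_ r2]].
    by have := lt_le_trans tr (le_trans r2 t2); rewrite ltxx.
Qed.

End nearest_density.

(** * The measure with a given density *)

Section density_measure.
Context d (T : measurableType d) (R : realType) (mu : {measure set T -> \bar R}).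
Context (h : T -> R) (h_ge0 : forall x, 0 <= h x) (mh : measurable_fun setT h).

(** The proofs of sign and measurability are arguments so that the measure structure can be inferred
    from the term alone. *)
Definition density_measure of (forall x, 0 <= h x) & measurable_fun setT h :=
  fun A : set T => (\int[mu]_(x in A) (h x)%:E)%E.
Local Notation nu := (density_measure h_ge0 mh).

Let density_measure0 : nu set0 = 0%E.
Proof. by rewrite /density_measure integral_set0. Qed.

Let density_measure_ge0 A : (0 <= nu A)%E.
Proof. by apply: integral_ge0 => x _; rewrite lee_fin. Qed.

Let density_measure_sigma_additive : semi_sigma_additive nu.
Proof.
move=> /= F mF tF mUF; rewrite /density_measure; apply: cvg_toP.
  apply: ereal_nondecreasing_is_cvgn => m n mn.
  by apply: lee_sum_nneg_natr => // k _ _; exact: density_measure_ge0.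
rewrite ge0_integral_bigcup//=.
- by apply/measurable_EFinP; exact: measurable_funTS.
- by move=> x _; rewrite lee_fin.
Qed.

HB.instance Definition _ := isMeasure.Build _ _ _ nu
  density_measure0 density_measure_ge0 density_measure_sigma_additive.
End density_measure.

(** * Recognizing a density from rays, and integrating against it *)

Section has_density.
Context d (T : measurableType d) (R : realType) (P : probability T R).
Local Notation mu := (@lebesgue_measure R).

Lemma has_density_ray (Y : T -> R) (h : R -> R) :
  measurable_fun setT Y -> (forall x, 0 <= h x) -> measurable_fun setT h ->
  (forall t, P (Y @^-1` `]t, +oo[) = \int[mu]_(x in `]t, +oo[) (h x)%:E)%E ->
  has_density P Y h.
Proof.
move=> mY h0 mh PY A mA.
pose Y' : {mfun T >-> measurableTypeR R} := HB.pack (Y : T -> measurableTypeR R)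
  (isMeasurableFun.Build _ _ T (measurableTypeR R) Y mY).
(* Uniqueness of measures requires a sequence of generators that covers the line and on which the
   measure is finite. *)
pose ray (n : nat) := `](- n%:R : R), +oo[%classic.
apply: (@g_sigma_algebra_measure_unique _ R (measurableTypeR R)
  (@RGenOInfty.G R) _ ray _ _ (distribution P Y') (density_measure mu h0 mh)).
- by move=> _ [x ->].
- by move=> n; exists (- n%:R).
- rewrite -subTset => x _; exists (Num.Def.truncn `|x|).+1 => //; rewrite /ray/=.
  by rewrite in_itv/= andbT ltrNl (le_lt_trans (ler_norm _))// normrN truncnS_gt.
- move=> _ _ [x ->] [y ->]; exists (Num.max x y).
  by apply/seteqP; split => z /=; rewrite !in_itv/= !andbT gt_max => /andP.
- by move=> _ [x ->]; exact: PY.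
- move=> n; rewrite (le_lt_trans (probability_le1 _ _)) ?ltry//.
  exact: measurable_itv.
- suff : (@RGenOInfty.G R).-sigma.-measurable A by [].
  by rewrite -RGenOInfty.measurableE.
Qed.

(** The law of [Y] is absolutely continuous, and its Radon-Nikodym derivative equals [h] almost
    everywhere because both have the same integral over every measurable set. The change of
    variables for that derivative then gives the formula. *)
Lemma ge0_integral_has_density (Y : T -> R) (h k : R -> R) :
  measurable_fun setT Y -> (forall x, 0 <= h x) -> measurable_fun setT h ->
  (forall x, 0 <= k x) -> measurable_fun setT k ->
  has_density P Y h ->
  (\int[P]_t (k (Y t))%:E = \int[mu]_x (k x * h x)%:E)%E.
Proof.
move=> mY h0 mh k0 mk PY.
pose Y' : {mfun T >-> measurableTypeR R} := HB.pack (Y : T -> measurableTypeR R)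
  (isMeasurableFun.Build _ _ T (measurableTypeR R) Y mY).
pose nu : {finite_measure set (measurableTypeR R) -> \bar R} :=
  distribution P Y'.
have numu : nu `<< mu.
  apply/null_content_dominatesP => A mA muA0.
  rewrite [LHS](PY A mA) null_set_integral//.
  by apply/measurable_EFinP; exact: measurable_funTS.
have mEk : measurable_fun setT (EFin \o k) by exact/measurable_EFinP.
transitivity (\int[nu]_x (k x)%:E)%E.
  by rewrite (ge0_integral_distribution Y')// => x; rewrite lee_fin.
rewrite -(Radon_Nikodym_SigmaFinite.change_of_variables numu)//.
have mRN := measurable_int _ (Radon_Nikodym_SigmaFinite.f_integrable numu).
apply: ae_eq_integral => //.
- exact: emeasurable_funM.
- by apply/measurable_EFinP; exact: measurable_funM.
suff RNh : ae_eq mu setT (Radon_Nikodym_SigmaFinite.f nu mu) (EFin \o h).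
  by apply: filterS RNh => x /= /[apply] ->.
apply: integral_ae_eq => //.
- exact: Radon_Nikodym_SigmaFinite.f_integrable.
- exact/measurable_EFinP.
- move=> A _ mA.
  by rewrite -Radon_Nikodym_SigmaFinite.f_integral// -PY.
Qed.

End has_density.

(** * The minimum of finitely many independent variables *)

Section minfam.
Context {T : Type} {R : realType}.

Lemma lt_foldr_min (t x : R) (s : seq R) :
  (t < foldr Num.min x s) = (t < x) && all (fun y => t < y) s.
Proof. by elim: s => [|y s IH] /=; rewrite ?andbT// lt_min IH andbCA. Qed.

Lemma lt_minfam N (X : 'I_N.+1 -> T -> R) (t : R) (u : T) :
  t < minfam X u <-> (forall i, t < X i u).
Proof.
rewrite /minfam; case E : (enum 'I_N.+1) => [|i0 s].
  (* The default branch of [minfam] would need an empty enumeration of [N.+1] indices. *)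
  by have := size_enum_ord N.+1; rewrite E.
rewrite [in X in X <-> _]/= lt_foldr_min all_map.
split=> [/andP[ti0 /allP ts] i|H].
  have : i \in enum 'I_N.+1 by rewrite mem_enum.
  by rewrite E inE => /predU1P[->//|/ts].
by rewrite H; apply/allP => i _; exact: H.
Qed.

End minfam.

Section law_of_minimum.
Context d (T : measurableType d) (R : realType) (P : probability T R).
Context N (X : 'I_N.+1 -> {RV P >-> R}).

(** Upper rays suit a minimum: it exceeds [t] exactly when every member does, so the event is an
    intersection, which independence turns into a product. *)
Lemma preimage_minfam_ray (t : R) :
  minfam (fun i => X i : T -> R) @^-1` `]t, +oo[ =
  \big[setI/setT]_(i < N.+1) (X i @^-1` `]t, +oo[).
Proof.
rewrite -bigcap_seq; apply/seteqP; split=> u /=.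
  by rewrite in_itv/= andbT => /lt_minfam H i _/=; rewrite in_itv/= andbT.
move=> H; rewrite in_itv/= andbT; apply/lt_minfam => i.
by have := H i; rewrite /= in_itv/= andbT; apply; rewrite mem_index_enum.
Qed.

Lemma measurable_minfam : measurable_fun setT (minfam (fun i => X i : T -> R)).
Proof.
apply: (measurability _ (RGenOInfty.measurableE R)) => _ [_ [t ->] <-].
rewrite setTI preimage_minfam_ray; apply: bigsetI_measurable => i _.
by rewrite -[X in measurable X]setTI; exact: measurable_funPT.
Qed.

Lemma mutually_independent_minfam_ray (t : R) :
  mutually_independent P (fun i => X i : T -> R) ->
  P (minfam (fun i => X i : T -> R) @^-1` `]t, +oo[) =
  (\prod_(i < N.+1) P (X i @^-1` `]t, +oo[))%E.
Proof. by move=> indep; rewrite preimage_minfam_ray indep. Qed.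

End law_of_minimum.

Lemma prod_EFin_const (R : realType) n (x : R) :
  (\prod_(i < n) x%:E = (x ^+ n)%:E)%E.
Proof. by rewrite prodEFin prodr_const card_ord. Qed.

(** Converts bounds on path loss or transmit power into bounds on distance. *)
Lemma le_powR_inv (R : realType) (x y a : R) : 0 < a -> 0 <= x -> 0 <= y ->
  (x `^ a <= y) = (x <= y `^ a^-1).
Proof.
move=> a0 x0 y0; have K (z : R) : 0 <= z -> (z `^ a) `^ a^-1 = z.
  by move=> z0; rewrite -powRrM divff ?gt_eqF// powRr1.
have ai0 : 0 <= a^-1 by rewrite invr_ge0 ltW.
apply/idP/idP => [xy|xy].
  by rewrite -[leLHS]K// ge0_ler_powR ?nnegrE ?powR_ge0.
have -> : y = (y `^ a^-1) `^ a by rewrite -powRrM mulVf ?gt_eqF// powRr1.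
by rewrite ge0_ler_powR ?nnegrE ?powR_ge0// ltW.
Qed.

(** * Law of the nearest distance and mean transmit power *)

Section nearest_aggregator.
Context {R : realType} (Rd : R).
Hypothesis Rd_gt0 : 0 < Rd.
Local Notation mu := (@lebesgue_measure R).
Local Notation g n := (fun r => fCI Rd r * (1 - PsiCI Rd r) ^+ n).

Let g_ge0 n r : 0 <= g n r := fCI_PsiCI_ge0 Rd_gt0 n r.

Let measurable_gZ n (k : R -> R) (A : set R) : measurable_fun setT k ->
  measurable_fun A (fun r => (k r * g n r)%:E).
Proof.
move=> mk; apply/measurable_EFinP/measurable_funTS/measurable_funM => //.
exact: measurable_fCI_PsiCI.
Qed.

Lemma has_density_minfam d (T : measurableType d) (P : probability T R) n
    (X : 'I_n.+1 -> {RV P >-> R}) :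
  mutually_independent P (fun i => X i : T -> R) ->
  (forall i, has_density P (X i) (fCI Rd)) ->
  has_density P (minfam (fun i => X i : T -> R)) (fun r => n.+1%:R * g n r).
Proof.
move=> indep dX; apply: has_density_ray => [|r||t].
- exact: measurable_minfam.
- by rewrite mulr_ge0.
- by apply: measurable_funM => //; exact: measurable_fCI_PsiCI.
rewrite mutually_independent_minfam_ray// integral_fCI_PsiCI_ray//.
rewrite -prod_EFin_const.
apply: eq_bigr => i _; rewrite dX//.
(* The ray integral, used above for [n], is used here for 0 to identify the tail of a single
   distance. *)
rewrite -[disk_survival _ _]expr1 -integral_fCI_PsiCI_ray//.
by apply: eq_integral => r _; rewrite expr0 mulr1 mul1r.
Qed.

(** The coverage bound [z] can equal [2 * Rd]; there the minimum with 1 replaces this value by the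
    correct probability 1. *)
Lemma PsiCI_end : PsiCI Rd (2 * Rd) = 2.
Proof.
have R0 : Rd != 0 by rewrite gt_eqF.
have pi0 : (pi : R) != 0 by rewrite gt_eqF ?pi_gt0.
have as1 : asin 1 = pi / 2 :> R.
  by have := @acosE_asin R 1; rewrite acos1; lra.
rewrite /PsiCI divff ?mulf_neq0// acos1 as1.
rewrite (_ : 4 * Rd ^+ 2 - _ = 0); last ring.
rewrite sqrtr0 invr0 !mulr0 atan0; move: (pi : R) pi0 => p p0; field.
by rewrite p0 R0.
Qed.

Lemma integral_fCI_itv0 (z : R) : 0 < z -> z <= 2 * Rd ->
  (\int[mu]_(r in `[0%R, z]) (g 0 r)%:E = (Num.min (PsiCI Rd z) 1)%:E)%E.
Proof.
move=> z0 z2.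
transitivity (\int[mu]_(r in `[0%R, z]) (1%:R * g 0 r)%:E)%E.
  by apply: eq_integral => r _; rewrite mul1r.
rewrite integral_fCI_PsiCI//; last exact: ltW.
rewrite mul0r disk_cdf0 subr0 !expr1 opprB addrCA subrr addr0; congr EFin.
move: z2; rewrite le_eqVlt => /predU1P[->|z2].
  by rewrite PsiCI_end divff ?gt_eqF ?mulr_gt0// disk_cdf1 min_r// ler1n.
rewrite PsiCIE// ?(ltW z0)// min_l//.
have zb : 0 <= z <= 2 * Rd by rewrite !ltW.
by have /andP[] := disk_cdf_itv (scaled_itv Rd_gt0 zb).
Qed.

Lemma integral_PT_fCI_PsiCI n (Po Pmax eps ag : R) :
  0 < Po -> 0 < Pmax -> 0 < eps * ag ->
  let zeta := Num.min (2 * Rd) ((Pmax / Po) `^ (eps * ag)^-1) in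
  (\int[mu]_r (PT Po Pmax eps ag r * g n r)%:E =
   Pmax%:E * \int[mu]_(r in `[zeta, (2 * Rd)%R]) (g n r)%:E
   + Po%:E * \int[mu]_(r in `[0%R, zeta]) (r `^ (eps * ag) * g n r)%:E)%E.
Proof.
move=> Po0 Pm0 a0 zeta; set a := eps * ag in a0 zeta *.
have zeta0 : 0 <= zeta by rewrite le_min powR_ge0 mulr_ge0// ltW.
have zeta2 : zeta <= 2 * Rd by rewrite ge_min lexx.
have PT0 r : 0 <= PT Po Pmax eps ag r.
  by rewrite le_min (ltW Pm0) andbT mulr_ge0 ?powR_ge0// ltW.
have mpow : measurable_fun setT (fun r : R => r `^ a) by exact: measurable_powR.
have mPT : measurable_fun setT (PT Po Pmax eps ag).
  by apply: measurable_minr => //; exact: measurable_funM.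
have mg A : measurable_fun A (fun r => (g n r)%:E).
  by apply/measurable_EFinP/measurable_funTS; exact: measurable_fCI_PsiCI.
rewrite integral_fCI_PsiCI_support// setTI.
(* The transmit power is [Pmax] on the first piece and the power law on the second. Leaving [zeta]
   out of the first makes them disjoint. *)
have -> : `[0, 2 * Rd]%classic = `]zeta, 2 * Rd]%classic `|` `[0, zeta]%classic.
  by rewrite setUC -itv_bndbnd_setU// bnd_simp.
rewrite ge0_integral_setU//; last 3 first.
- exact: measurable_gZ.
- by move=> r _; rewrite lee_fin mulr_ge0.
- apply/disj_setPS => r [/=]; rewrite !in_itv/= => /andP[zr _] /andP[_].
  by rewrite leNgt zr.
congr (_ + _)%E.
  rewrite -integral_itv_obnd_cbnd//.
  rewrite -ge0_integralZl_EFin//; last 3 first.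
  - by move=> r _; rewrite lee_fin.
  - exact: mg.
  - exact: ltW.
  apply: eq_integral => r; rewrite inE/= in_itv/= => /andP[zr r2].
  rewrite -EFinM /PT -/a min_r//.
  have r0 : 0 <= r by rewrite (le_trans zeta0)// ltW.
  rewrite -ler_pdivrMl// mulrC leNgt; apply/negP => rP.
  (* As [r <= 2 * Rd], the bound [zeta < r] can only come from the saturation distance. *)
  move: zr; rewrite gt_min (ltNge (2 * Rd)) r2/=; apply/negP; rewrite -leNgt.
  by rewrite -le_powR_inv// ?divr_ge0 ?ltW.
rewrite -ge0_integralZl_EFin//; last 3 first.
- by move=> r _; rewrite lee_fin mulr_ge0// powR_ge0.
- exact: measurable_gZ.
- exact: ltW.
apply: eq_integral => r; rewrite inE/= in_itv/= => /andP[r0].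
rewrite le_min => /andP[_ rz]; rewrite -EFinM /PT -/a min_l -?mulrA//.
by rewrite mulrC -ler_pdivlMr// le_powR_inv// divr_ge0// ltW.
Qed.

End nearest_aggregator.

(** * Mean consumed power and coverage probability *)

Theorem theorem2 (R : realType) (Rd : R) (N : nat)
  (d : measure_display) (T : measurableType d) (P : probability T R)
  (X : 'I_N -> {RV P >-> R})
  (Po Pmax Pcp eta eps ag Lo mu : R) :
  0 < Rd -> (1 <= N)%N ->
  mutually_independent P (fun i => X i : T -> R) ->
  (forall i, has_density P (X i) (fCI Rd)) ->
  0 < Po -> 0 < Pmax -> 0 <= Pcp -> 0 < eta -> 0 < eps -> eps <= 1 ->
  0 < ag -> 0 < Lo -> 0 < mu ->
  let r := minfam (fun i => X i : T -> R) in
  let zeta := Num.min (2 * Rd) ((Pmax / Po) `^ (eps * ag)^-1) in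
  let g := fun x => fCI Rd x * (1 - PsiCI Rd x) ^+ N.-1 in
  let muh := mu / Lo in
  let z := Num.min (muh `^ ag^-1) (2 * Rd) in
  ((\int[P]_t (PTX Pcp eta Po Pmax eps ag (r t))%:E)%E =
     (Pcp%:E + (eta^-1 * N%:R)%:E *
       (Pmax%:E * \int[@lebesgue_measure R]_(x in [set` `[zeta, (2 * Rd)%R]]) (g x)%:E
        + Po%:E * \int[@lebesgue_measure R]_(x in [set` `[0%R, zeta]])
                     (x `^ (eps * ag) * g x)%:E))%E)
  /\
  P [set t | Lo * r t `^ ag <= mu] =
    ((N%:R)%:E * \int[@lebesgue_measure R]_(x in [set` `[0%R, z]]) (g x)%:E)%E
  /\
  (N = 1%N -> P [set t | Lo * r t `^ ag <= mu] =
               (Num.min (PsiCI Rd z) 1)%:E).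
Proof.
move=> Rd0; case: N X => [//|n] X _ indep dX Po0 Pm0 Pcp0 eta0 eps0 _ ag0 Lo0 mu0.
move=> r zeta g muh z.
have dr := has_density_minfam Rd0 indep dX; rewrite -/r in dr.
have mr : measurable_fun setT r by exact: measurable_minfam.
have g0 x : 0 <= g x by exact: fCI_PsiCI_ge0.
have mg : measurable_fun setT g by exact: measurable_fCI_PsiCI.
have a0 : 0 < eps * ag by rewrite mulr_gt0.
have muh0 : 0 < muh by rewrite divr_gt0.
have z0 : 0 < z by rewrite lt_min powR_gt0//= mulr_gt0.
have z2 : z <= 2 * Rd by rewrite ge_min lexx orbT.
have cov : P [set t | Lo * r t `^ ag <= mu] =
    ((n.+1%:R)%:E * \int[@lebesgue_measure R]_(x in [set` `[0%R, z]]) (g x)%:E)%E.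
  have mA : measurable [set x : R | Lo * x `^ ag <= mu].
    rewrite -[X in measurable X]setTI.
    apply: (@measurable_fun_ler _ _ _ setT (fun x : R => Lo * x `^ ag) (cst mu)
      _ _ _ [set true]) => //.
    by apply: measurable_funM => //; exact: measurable_powR.
  rewrite (dr _ mA) integral_fCI_PsiCI_support//.
  rewrite -ge0_integralZl_EFin//; last 2 first.
  - by move=> x _; rewrite lee_fin.
  - by apply/measurable_EFinP; exact: measurable_funTS.
  (* Within the support distances are nonnegative, so the path loss bound can be inverted and leaves
     an initial interval. *)
  rewrite (_ : _ `&` _ = `[0, z]%classic)//.
  apply/seteqP; split=> x /=; rewrite !in_itv/= /z le_min.
    move=> [xmu /andP[x0 ->]]; rewrite x0 andbT/= -le_powR_inv//; last exact: ltW.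
    by rewrite ler_pdivlMr// mulrC.
  move=> /andP[x0 /andP[xz ->]]; rewrite x0; split => //.
  by rewrite mulrC -ler_pdivlMr// le_powR_inv//; exact: ltW.
split; last by split=> // -[n0]; rewrite cov /g /= n0 mul1e integral_fCI_itv0.
have PT0 x : 0 <= PT Po Pmax eps ag x.
  by rewrite le_min (ltW Pm0) andbT mulr_ge0 ?powR_ge0// ltW.
have mPT : measurable_fun setT (PT Po Pmax eps ag).
  apply: measurable_minr => //.
  by apply: measurable_funM => //; exact: measurable_powR.
have mPTr : measurable_fun setT (fun t => (PT Po Pmax eps ag (r t))%:E).
  by apply/measurable_EFinP; exact: (measurableT_comp mPT).
transitivity (\int[P]_t (Pcp%:E + eta^-1%:E * (PT Po Pmax eps ag (r t))%:E))%E.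
  by apply: eq_integral => t _.
rewrite ge0_integralD//; last 2 first.
- by move=> t _; rewrite mule_ge0 ?lee_fin ?invr_ge0// ltW.
- exact: measurable_funeM.
rewrite integral_cst// [X in (_ * X + _ = _)%E](@probability_setT _ _ _ P) mule1.
congr (_ + _)%E.
rewrite ge0_integralZl_EFin//; last 2 first.
- by move=> t _; rewrite lee_fin.
- by rewrite invr_ge0 ltW.
rewrite EFinM -muleA; congr (_ * _)%E.
have dr0 x : 0 <= n.+1%:R * g x by rewrite mulr_ge0.
have mdr : measurable_fun setT (fun x => n.+1%:R * g x) by exact: measurable_funM.
(* With the constant circuit power split off, the mean transmit power becomes a Lebesgue integral
   over distances. *)
rewrite (ge0_integral_has_density mr dr0 mdr PT0 mPT dr).
rewrite -integral_PT_fCI_PsiCI// -ge0_integralZl_EFin//; last 2 first.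
- by move=> x _; rewrite lee_fin mulr_ge0 ?fCI_PsiCI_ge0.
- by apply/measurable_EFinP; exact: measurable_funM.
by apply: eq_integral => x _; rewrite -EFinM mulrCA.
Qed.
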